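(* Any Wajsberg algebra $(X,\to,{}^*,1)$ is a quantum-Wajsberg algebra.
   Context: A Wajsberg algebra is an algebra $(X,\to,{}^*,1)$ of type $(2,1,0)$ such that for all $x,y,z\in X$: $1\to x=x$; $(y\to z)\to((z\to x)\to(y\to x))=1$; $(x\to y)\to y=(y\to x)\to x$; $(x^*\to y^* )\to(y\to x)=1$. Put $0:=1^*$. A BE algebra is an algebra $(X,\to,1)$ of type $(2,0)$ such that for all $x,y,z\in X$: $x\to x=1$; $x\to 1=1$; $1\to x=x$; $x\to(y\to z)=y\to(x\to z)$. Write $x\le y$ iff $x\to y=1$. It is bounded if there is $0\in X$ with $0\le x$ for all $x$; then $x^*:=x\to 0$. A bounded BE algebra is involutive if $x^{**}=x$ for all $x$; it is then written $(X,\to,{}^*,1)$, with $0=1^*$. In an involutive BE algebra put $x\vee y:=(x\to y)\to y$ and $x\wedge y:=(x^*\vee y^* )^*=((x^*\to y^* )\to y^* )^*$. A quantum-Wajsberg algebra is an involutive BE algebra (with $x^*=x\to 0$, $0=1^*$) satisfying $x\to ((x\wedge y)\wedge (z\wedge x))=(x\to y)\wedge (x\to z)$ for all $x,y,z\in X$. *)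

(* Defs.v *)
Set Implicit Arguments.
Unset Strict Implicit.
Unset Printing Implicit Defensive.

(* An algebra [(X, ->, *, 1)] is given by its carrier [X : Type] and its
   operations [imp], [star], [one]; each class of algebras is a predicate on
   these operations. *)

Record wajsberg (X : Type) (imp : X -> X -> X) (star : X -> X) (one : X)
  : Prop := Wajsberg {
  wajsberg_imp1x : forall x, imp one x = x;
  wajsberg_trans : forall x y z,
    imp (imp y z) (imp (imp z x) (imp y x)) = one;
  wajsberg_joinC : forall x y, imp (imp x y) y = imp (imp y x) x;
  wajsberg_contra : forall x y, imp (imp (star x) (star y)) (imp y x) = one
}.

Record be_algebra (X : Type) (imp : X -> X -> X) (one : X)
  : Prop := BEAlgebra {
  be_impxx : forall x, imp x x = one;
  be_impx1 : forall x, imp x one = one;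
  be_imp1x : forall x, imp one x = x;
  be_impCA : forall x y z, imp x (imp y z) = imp y (imp x z)
}.

Definition be_le (X : Type) (imp : X -> X -> X) (one : X) (x y : X) : Prop :=
  imp x y = one.

(* In a BE algebra [be_le] need not be antisymmetric, so the bottom element
   is a parameter. *)
Record bounded_be_algebra (X : Type) (imp : X -> X -> X) (one zero : X)
  : Prop := BoundedBEAlgebra {
  bounded_be_be : be_algebra imp one;
  bounded_be_le0x : forall x, be_le imp one zero x
}.

(* In the signature [(->, *, 1)] the bottom element is [star one]. *)
Record involutive_be_algebra (X : Type) (imp : X -> X -> X) (star : X -> X)
    (one : X) : Prop := InvolutiveBEAlgebra {
  involutive_be_bounded : bounded_be_algebra imp one (star one);
  involutive_be_starE : forall x, star x = imp x (star one);
  involutive_be_starK : forall x, star (star x) = x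
}.

Definition qw_join (X : Type) (imp : X -> X -> X) (x y : X) : X :=
  imp (imp x y) y.

Definition qw_meet (X : Type) (imp : X -> X -> X) (star : X -> X)
    (x y : X) : X :=
  star (qw_join imp (star x) (star y)).

Record quantum_wajsberg (X : Type) (imp : X -> X -> X) (star : X -> X)
    (one : X) : Prop := QuantumWajsberg {
  quantum_wajsberg_be : involutive_be_algebra imp star one;
  quantum_wajsberg_QW : forall x y z,
    imp x (qw_meet imp star (qw_meet imp star x y) (qw_meet imp star z x)) =
    qw_meet imp star (imp x y) (imp x z)
}.

(* Main.v *)
(** The relation [x -> y = 1] is a partial order in which [join] is the
    supremum and, by contraposition, [meet] the infimum. With the product
    [w . x := star (w -> star x)], [w <= x -> u] iff [w . x <= u]. As
    [w . x <= x] always holds, both sides of the quantum-Wajsberg identity have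
    the same lower bounds: those [w] with [w . x <= y] and [w . x <= z]. *)

Require Import Defs.
From Stdlib Require Import Setoid.

Section WajsbergTheory.

Set Implicit Arguments.
Unset Strict Implicit.

Variables (X : Type) (imp : X -> X -> X) (star : X -> X) (one : X).
Hypothesis hW : wajsberg imp star one.

Local Infix "~>" := imp (at level 55, right associativity).
Local Notation "x <= y" := (be_le imp one x y) (at level 70).
Local Notation zero := (star one).
Local Notation join := (qw_join imp).
Local Notation meet := (qw_meet imp star).
Local Notation imp1x := (wajsberg_imp1x hW).
Local Notation joinC := (wajsberg_joinC hW).

Lemma wajsberg_impxx x : x ~> x = one.
Proof.
pose proof (wajsberg_trans hW x one one) as H.
now rewrite !imp1x in H.
Qed.

Lemma wajsberg_le_anti x y : x <= y -> y <= x -> x = y.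
Proof.
unfold be_le; intros Hxy Hyx.
pose proof (joinC x y) as H.
now rewrite Hxy, Hyx, !imp1x in H.
Qed.

Lemma wajsberg_imp_anti x y z : x <= y -> (y ~> z) <= (x ~> z).
Proof.
unfold be_le; intros Hxy.
pose proof (wajsberg_trans hW z x y) as H.
now rewrite Hxy, imp1x in H.
Qed.

Lemma wajsberg_le_trans y x z : x <= y -> y <= z -> x <= z.
Proof.
intros Hxy Hyz.
pose proof (wajsberg_imp_anti z Hxy) as H.
unfold be_le in *.
now rewrite Hyz, imp1x in H.
Qed.

Lemma wajsberg_le_join_l x y : x <= join x y.
Proof.
pose proof (wajsberg_trans hW y one x) as H.
now rewrite !imp1x in H.
Qed.

(** By [joinC], [join x one] equals [join one x = x ~> x = one]. *)
Lemma wajsberg_lex1 x : x <= one.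
Proof.
pose proof (wajsberg_le_join_l x one) as H.
unfold be_le, qw_join in *.
now rewrite (joinC x one), imp1x, wajsberg_impxx in H.
Qed.

Lemma wajsberg_le_imp x y : x <= (y ~> x).
Proof.
pose proof (wajsberg_imp_anti x (wajsberg_lex1 y)) as H.
now rewrite imp1x in H.
Qed.

(** Transitivity through [y ~> z] gives the premise [join y z], which is then lowered to [y]. *)
Lemma wajsberg_impCA_le x y z : (x ~> y ~> z) <= (y ~> x ~> z).
Proof.
apply (wajsberg_le_trans (y := join y z ~> x ~> z)).
- exact (wajsberg_trans hW z x (y ~> z)).
- apply wajsberg_imp_anti, wajsberg_le_join_l.
Qed.

Lemma wajsberg_impCA x y z : x ~> y ~> z = y ~> x ~> z.
Proof. apply wajsberg_le_anti; apply wajsberg_impCA_le. Qed.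

(** Contraposition at [one] gives [zero <= (star x ~> zero) <= x]. *)
Lemma wajsberg_le0x x : zero <= x.
Proof.
apply (wajsberg_le_trans (wajsberg_le_imp zero (star x))).
pose proof (wajsberg_contra hW x one) as H.
now rewrite imp1x in H.
Qed.

Lemma wajsberg_imp0K x : (x ~> zero) ~> zero = x.
Proof. now rewrite joinC, (wajsberg_le0x x), imp1x. Qed.

Lemma wajsberg_starE x : star x = x ~> zero.
Proof.
apply wajsberg_le_anti.
- apply (wajsberg_le_trans (wajsberg_le_imp (star x) (star zero))).
  exact (wajsberg_contra hW zero x).
(* Writing [star x] as a double negation by [zero] leaves [star x ~> zero <= x], again
   contraposition at [one]. *)
- rewrite <- (wajsberg_imp0K (star x)).
  apply wajsberg_imp_anti.
  pose proof (wajsberg_contra hW x one) as H.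
  now rewrite imp1x in H.
Qed.

Lemma wajsberg_starK x : star (star x) = x.
Proof. now rewrite (wajsberg_starE (star x)), (wajsberg_starE x), wajsberg_imp0K. Qed.

Lemma wajsberg_imp_starC x y : x ~> star y = y ~> star x.
Proof. now rewrite (wajsberg_starE x), (wajsberg_starE y), wajsberg_impCA. Qed.

(** Exchange and contraposition bring both implications to [star u ~> (w ~> star x)]. *)
Lemma wajsberg_le_imp_adj w x u :
  w <= (x ~> u) <-> star (w ~> star x) <= u.
Proof.
unfold be_le.
rewrite <- (wajsberg_starK u), (wajsberg_imp_starC x), wajsberg_impCA.
now rewrite (wajsberg_imp_starC (star _)), wajsberg_starK.
Qed.

Lemma wajsberg_join_le x y z : join x y <= z <-> x <= z /\ y <= z.
Proof.
split.
- intros H; split; apply (fun h => wajsberg_le_trans h H).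
  + apply wajsberg_le_join_l.
  + apply wajsberg_le_imp.
- intros [Hx Hy].
  (* [join] is monotone in its first argument, so [x <= z] gives [join x y <= join z y], and the
     latter is [z] because [y <= z]. *)
  assert (Hz : join z y = z)
    by (unfold qw_join; now rewrite joinC, Hy, imp1x).
  rewrite <- Hz.
  now apply wajsberg_imp_anti, wajsberg_imp_anti.
Qed.

Lemma wajsberg_le_meet w x y : w <= meet x y <-> w <= x /\ w <= y.
Proof.
assert (Hstar : forall u, w <= u <-> star u <= star w).
{ intros u; unfold be_le.
  now rewrite (wajsberg_imp_starC (star u)), wajsberg_starK. }
unfold qw_meet.
rewrite (Hstar (star _)), (Hstar x), (Hstar y), wajsberg_starK.
apply wajsberg_join_le.
Qed.

Lemma wajsberg_eq_of_lower_bounds a b :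
  (forall w, w <= a <-> w <= b) -> a = b.
Proof.
intros H; apply wajsberg_le_anti; apply H, wajsberg_impxx.
Qed.

Lemma wajsberg_imp_meet x y z :
  x ~> meet (meet x y) (meet z x) = meet (x ~> y) (x ~> z).
Proof.
apply wajsberg_eq_of_lower_bounds; intros w.
rewrite wajsberg_le_meet, !wajsberg_le_imp_adj, !wajsberg_le_meet.
(* The left side also demands, twice, that the product of [w] and [x] lie below [x]; by adjunction
   this is [w <= x ~> x = one]. *)
assert (Hx : star (w ~> star x) <= x).
{ apply wajsberg_le_imp_adj.
  rewrite wajsberg_impxx.
  apply wajsberg_lex1. }
tauto.
Qed.

End WajsbergTheory.

Theorem proposition4p9 (X : Type) (imp : X -> X -> X) (star : X -> X) (one : X)
    (hW : wajsberg imp star one) : quantum_wajsberg imp star one.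
Proof.
split; [split; [split; [split|]| |]|].
- exact (wajsberg_impxx hW).
- exact (wajsberg_lex1 hW).
- exact (wajsberg_imp1x hW).
- exact (wajsberg_impCA hW).
- exact (wajsberg_le0x hW).
- exact (wajsberg_starE hW).
- exact (wajsberg_starK hW).
- exact (wajsberg_imp_meet hW).
Qed.
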